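(* Let $t$ be a binary tree with $n$ nodes whose nodes are partitioned into micro trees $\mu_1,\dots,\mu_m$ by the Farzan–Munro algorithm with parameter $B$, and split $\mathrm{BP}_\mathrm{b}(t)$ into the left and right chunks of the micro trees as described in the context. Replace every left chunk by a single $\texttt{(}$ and every right chunk (including the empty ones) by a single $\texttt{)}$. The resulting sequence of $2m$ parentheses is the $\mathrm{BP}_\mathrm{b}$ encoding of a binary tree whose nodes correspond to the micro trees (micro tree $\mu$ corresponding to the matching pair formed by the two parentheses replacing its chunks) and in which $\mu_c$ is a child of $\mu_p$ if and only if $\mu_c$ is a child micro tree of $\mu_p$, i.e., this binary tree is the top-tier tree.
   Context: A binary tree is a rooted tree where each node has a left and a right child slot, each possibly empty. $\mathrm{BP}_\mathrm{b}(t)=\epsilon$ if $t$ is empty and otherwise $\texttt{(}\cdot \mathrm{BP}_\mathrm{b}(t_l)\cdot \texttt{)}\cdot \mathrm{BP}_\mathrm{b}(t_r)$, with $t_l,t_r$ the left and right subtrees of the root; node $v$ corresponds to the matching pair inserted when expanding the subtree rooted at $v$. The Farzan–Munro algorithm with parameter $B$ partitions the nodes of a binary tree into disjoint micro trees, each a connected set of nodes rooted at its topmost node; it is known that contracting each micro tree into a single node yields a binary tree (the top-tier tree) and that any micro tree with two child micro trees consists of a single node. A child micro tree of $\mu$ is a micro tree whose root's parent lies in $\mu$. The positions in $\mathrm{BP}_\mathrm{b}(t)$ of the parentheses of the nodes of a micro tree $\mu$ form one or two maximal intervals of consecutive positions. Chunks: if there are two such intervals, the left chunk is the left one and the right chunk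 is the right one; if there is one interval, the left chunk is that interval and the right chunk is an empty interval located immediately after it. *)

(* Defs.v *)
From mathcomp Require Import all_boot.
Set Implicit Arguments.
Unset Strict Implicit.
Unset Printing Implicit Defensive.

Inductive bintree : Type := Empty | Node of bintree & bintree.

(* The root of [Node l r] is [None]; the nodes of its left (right) subtree are
   the [Some (inl u)] (the [Some (inr u)]). *)
Fixpoint node (t : bintree) : finType :=
  match t with
  | Empty => void : finType
  | Node l r => option (node l + node r) : finType
  end.

Definition root (t : bintree) : option (node t) :=
  match t return option (node t) with
  | Empty => None
  | Node l r => Some (None : node (Node l r))
  end.

(* [child_at true v] is the node in the left child slot of [v], and
   [child_at false v] the one in the right slot; [None] is an empty slot. *)
Fixpoint child_at (left : bool) (t : bintree) : node t -> option (node t) :=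
  match t return node t -> option (node t) with
  | Empty => fun v => match v with end
  | Node l r => fun v : option (node l + node r) =>
      match v with
      | None => if left then omap (fun u => Some (inl u)) (root l)
                else omap (fun u => Some (inr u)) (root r)
      | Some (inl u) => omap (fun w => Some (inl w)) (child_at left u)
      | Some (inr u) => omap (fun w => Some (inr w)) (child_at left u)
      end
  end.

Definition child (t : bintree) : rel (node t) :=
  fun p c => (child_at true p == Some c) || (child_at false p == Some c).

(* Opening and closing parentheses are [true] and [false]. *)
Fixpoint BPb (t : bintree) : seq bool :=
  match t with
  | Empty => [::]
  | Node l r => true :: BPb l ++ false :: BPb r
  end.

(* Positions, counted from 0, of the pair inserted when the subtree rooted at
   the given node is expanded. *)
Fixpoint open_pos (t : bintree) : node t -> nat :=
  match t return node t -> nat with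
  | Empty => fun v => match v with end
  | Node l r => fun v : option (node l + node r) =>
      match v with
      | None => 0
      | Some (inl u) => (open_pos u).+1
      | Some (inr u) => (size (BPb l)).+2 + open_pos u
      end
  end.

Fixpoint close_pos (t : bintree) : node t -> nat :=
  match t return node t -> nat with
  | Empty => fun v => match v with end
  | Node l r => fun v : option (node l + node r) =>
      match v with
      | None => (size (BPb l)).+1
      | Some (inl u) => (close_pos u).+1
      | Some (inr u) => (size (BPb l)).+2 + close_pos u
      end
  end.

Section MicroTrees.

Variable t : bintree.
Implicit Types (M : {set node t}) (P : {set {set node t}}).

Definition connected_in M : bool :=
  [forall u in M, forall v in M,
     connect [rel x y | [&& x \in M, y \in M & child x y || child y x]] u v].

(* [r] is the topmost node of [M]: it lies in [M] and is an ancestor of every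
   node of [M]. *)
Definition topmost M (r : node t) : bool :=
  (r \in M) && [forall v in M, connect (@child t) r v].

Definition child_micro_tree M M' : bool :=
  [exists r, topmost M' r && [exists p in M, child p r]].

(* Contracting disjoint connected sets of nodes of a binary tree always gives a
   rooted tree; it is a binary tree when every micro tree has at most two child
   micro trees, which is the third clause. *)
Definition micro_tree_decomposition P : Prop :=
  [/\ partition P [set: node t],
      forall M, M \in P -> connected_in M /\ exists r, topmost M r,
      forall M, M \in P -> #|[set M' in P | child_micro_tree M M']| <= 2
    & forall M, M \in P ->
        #|[set M' in P | child_micro_tree M M']| = 2 -> #|M| = 1].

Definition position_of M (i : nat) : bool :=
  [exists v in M, (i == open_pos v) || (i == close_pos v)].

(* The pair [(a, b)] stands for the interval of the positions i with
   a <= i < b. *)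
Definition maximal_interval M (I : nat * nat) : bool :=
  [&& I.1 < I.2,
      all (position_of M) (iota I.1 (I.2 - I.1)),
      (I.1 == 0) || ~~ position_of M I.1.-1
    & ~~ position_of M I.2].

(* Listed from left to right. *)
Definition maximal_intervals M : seq (nat * nat) :=
  let N := (size (BPb t)).+1 in
  [seq I <- [seq (a, b) | a <- iota 0 N, b <- iota 0 N] | maximal_interval M I].

Definition left_chunk M : nat * nat := nth (0, 0) (maximal_intervals M) 0.

(* Without a second interval, this is the empty interval located at the end of
   the left chunk. *)
Definition right_chunk M : nat * nat :=
  nth ((left_chunk M).2, (left_chunk M).2) (maximal_intervals M) 1.

(* [(M, true)] is the left chunk of [M] and [(M, false)] its right chunk, so
   the second component is also the parenthesis replacing the chunk. *)
Definition chunk (c : {set node t} * bool) : nat * nat :=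
  if c.2 then left_chunk c.1 else right_chunk c.1.

(* Comparing the ends too puts an empty right chunk before the nonempty chunk
   that starts at the same position. *)
Definition chunk_le : rel ({set node t} * bool) :=
  fun c d => ((chunk c).1 < (chunk d).1)
          || ((chunk c).1 == (chunk d).1) && ((chunk c).2 <= (chunk d).2).

Definition chunks P : seq ({set node t} * bool) :=
  sort chunk_le [seq (M, b) | M <- enum P, b <- [:: true; false]].

Definition contracted_parens P : seq bool := [seq c.2 | c <- chunks P].

(* [T] is the top-tier tree of [P], its node [x] being the contraction of the
   micro tree [f x].  The slot of a child is prescribed only at micro trees
   reduced to a single node, where it is inherited from [t]: contracting
   several nodes leaves no canonical slot for an only child. *)
Definition top_tier_tree P (T : bintree) (f : node T -> {set node t}) : Prop :=
  [/\ injective f,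
      [set f x | x in node T] = P,
      forall p c : node T, child p c = child_micro_tree (f p) (f c)
    & forall (p c : node T) (v : node t) (left : bool), f p = [set v] ->
        (child_at left p == Some c) =
        [exists r, topmost (f c) r && (child_at left v == Some r)]].

End MicroTrees.

(* The algorithm, whose first argument is the parameter B, enters only through
   what is known of its output. *)
Definition farzan_munro_spec
    (FM : nat -> forall t : bintree, {set {set node t}}) : Prop :=
  forall (B : nat) (t : bintree), 0 < B -> micro_tree_decomposition (FM B t).

(* Main.v *)
Require Import Defs.
From mathcomp Require Import all_boot zify.
Set Implicit Arguments.
Unset Strict Implicit.
Unset Printing Implicit Defensive.

(* In BPb t the subtree of a node v occupies an interval that starts at the
   opening parenthesis of v, and the intervals of two nodes are nested or
   disjoint.  A micro tree M with topmost node r therefore occupies the interval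
   of r minus those of its exits: the nodes outside M whose parent is in M.  A
   connected set enters a subtree only through its root, so the exits are the
   topmost nodes of the child micro trees.  There are at most two of them, and
   two only when M is a single node, so the interval of r splits into the left
   chunk, a possibly empty gap, the right chunk and a possibly empty gap, each
   nonempty gap being the interval of one exit.  Reading the gaps as the left
   and right subtrees defines the contracted tree by recursion.  Its chunks tile
   the interval from left to right, so sorting the chunks yields exactly its
   parenthesis sequence. *)

(** * Positions of parentheses and intervals of subtrees *)

(** The encoding of a subtree continues after the closing parenthesis of its root with the right
    subtree, so [close_pos] does not delimit it. The interval meant is half-open, from [open_pos] to
    [end_pos]. *)
Fixpoint end_pos (t : bintree) : node t -> nat :=
  match t return node t -> nat with
  | Empty => fun v => match v with end
  | Node l r => fun v : option (node l + node r) =>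
      match v with
      | None => size (BPb (Node l r))
      | Some (inl u) => (end_pos u).+1
      | Some (inr u) => (size (BPb l)).+2 + end_pos u
      end
  end.

Lemma size_BPb_Node l r :
  size (BPb (Node l r)) = (size (BPb l) + size (BPb r)).+2.
Proof. by rewrite /= size_cat /= addnS. Qed.

Section Positions.

Variable t : bintree.
Implicit Types u v r c p : node t.

Lemma pos_bounds v :
  [&& open_pos v < close_pos v, close_pos v < end_pos v
    & end_pos v <= size (BPb t)].
Proof.
elim: t v => [[]|l IHl r IHr] [[u|u]|].
- by have := IHl u; rewrite size_BPb_Node /=; lia.
- by have := IHr u; rewrite size_BPb_Node /=; lia.
- by rewrite size_BPb_Node /= size_cat /=; lia.
Qed.

Lemma root_pos r :
  Defs.root t = Some r -> open_pos r = 0 /\ end_pos r = size (BPb t).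
Proof. by case: t r => // l r' v [<-]. Qed.

Lemma root_None : Defs.root t = None -> t = Empty.
Proof. by case: t. Qed.

End Positions.

Lemma left_child_pos t (v : node t) :
  if child_at true v is Some c then
    open_pos c = (open_pos v).+1 /\ end_pos c = close_pos v
  else close_pos v = (open_pos v).+1.
Proof.
elim: t v => [[]|l IHl r IHr] [[u|u]|] /=.
- by have := IHl u; case: child_at => [c|] /=; lia.
- by have := IHr u; case: child_at => [c|] /=; lia.
- case E: (Defs.root l) => [c|] /=; first by case: (root_pos E) => -> ->.
  by rewrite (root_None E).
Qed.

Lemma right_child_pos t (v : node t) :
  if child_at false v is Some c then
    open_pos c = (close_pos v).+1 /\ end_pos c = end_pos v
  else end_pos v = (close_pos v).+1.
Proof.
elim: t v => [[]|l IHl r IHr] [[u|u]|] /=.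
- by have := IHl u; case: child_at => [c|] /=; lia.
- by have := IHr u; case: child_at => [c|] /=; lia.
- rewrite size_cat /=; case E: (Defs.root r) => [c|] /=.
    by case: (root_pos E) => -> ->; lia.
  by rewrite (root_None E) /=; lia.
Qed.

Lemma open_pos_inj t : injective (@open_pos t).
Proof.
elim: t => [[]|l IHl r IHr] [[u|u]|] [[v|v]|] //= E.
- by rewrite (IHl u v) //; lia.
- by have := pos_bounds u; lia.
- by have := pos_bounds v; lia.
- by rewrite (IHr u v) //; lia.
Qed.

Lemma close_pos_inj t : injective (@close_pos t).
Proof.
elim: t => [[]|l IHl r IHr] [[u|u]|] [[v|v]|] //= E;
  try by [have := pos_bounds u; lia | have := pos_bounds v; lia].
- by rewrite (IHl u v) //; lia.
- by rewrite (IHr u v) //; lia.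
Qed.

Lemma open_neq_close t (u v : node t) : open_pos u != close_pos v.
Proof.
elim: t u v => [[]|l IHl r IHr] [[u|u]|] [[v|v]|] //=;
  try by [have := IHl u v; lia | have := IHr u v; lia
        | have := pos_bounds u; lia | have := pos_bounds v; lia].
Qed.

Lemma pos_cover t i :
  i < size (BPb t) -> exists v : node t, (i == open_pos v) || (i == close_pos v).
Proof.
elim: t i => // l IHl r IHr [|i]; first by exists None.
rewrite size_BPb_Node => lti; have [ltil|leli] := ltnP i (size (BPb l)).
  by have [u Eu] := IHl i ltil; exists (Some (inl u)).
case: (ltnP (size (BPb l)) i) => [ltli|]; last first.
  by exists None => /=; lia.
have [|u Eu] := IHr (i - (size (BPb l)).+1); first by lia.
by exists (Some (inr u)) => /=; lia.
Qed.

(* The intervals [open_pos, end_pos) of two nodes are nested or disjoint, and a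
   nested one does not straddle the closing parenthesis. *)
Lemma pos_laminar t (u v : node t) :
  (open_pos u <= open_pos v < end_pos u -> end_pos v <= end_pos u) /\
  (open_pos v < open_pos u < close_pos v -> end_pos u <= close_pos v).
Proof.
elim: t u v => [[]|l IHl r IHr] [[u|u]|] [[v|v]|] /=; rewrite ?size_cat /=;
  try by [have := IHl u v; lia | have := IHr u v; lia
        | have := pos_bounds u; have := pos_bounds v; lia
        | have := pos_bounds u; lia | have := pos_bounds v; lia | lia].
Qed.

(** * Ancestry expressed by positions *)

Section Ancestry.

Variable t : bintree.
Implicit Types u v r c p : node t.

Definition within v i := open_pos v <= i < end_pos v.

(** If [r] opened strictly between the parentheses of [v], laminarity would make its interval end no
    later than the closing one. *)
Lemma within_close r v : within r (close_pos v) = within r (open_pos v).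
Proof.
have := pos_laminar r v; have := pos_bounds v; have := pos_bounds r.
by have := open_neq_close r v; rewrite /within; lia.
Qed.

Lemma child_pos p c : child p c ->
  [/\ open_pos p < open_pos c, end_pos c <= end_pos p
    & open_pos c = (open_pos p).+1 \/ open_pos c = (close_pos p).+1].
Proof.
have b := pos_bounds p; case/orP=> /eqP E.
  have := left_child_pos p; rewrite E => -[-> ->]; split; [lia | lia | by left].
have := right_child_pos p; rewrite E => -[-> ->]; split; [lia | lia | by right].
Qed.

(** A child opens immediately after one of the two parentheses of its parent, and the parenthesis at
    that position belongs to a single node. *)
Lemma child_parent_inj p q c : child p c -> child q c -> p = q.
Proof.
move=> /child_pos[_ _ Ep] /child_pos[_ _ Eq].
have := open_neq_close p q; have := open_neq_close q p.
case: Ep Eq => -> [] [] E.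
- by move=> _ _; apply: open_pos_inj.
- by rewrite E eqxx.
- by rewrite E eqxx.
- by move=> _ _; apply: close_pos_inj.
Qed.

(** Apart from the two parentheses of [r], its interval consists of the intervals of its children. A
    descendant other than [r] therefore lies in that of one child, which is shorter. From here on
    ancestry is arithmetic. *)
Lemma connect_childE r v : connect (@child t) r v = within r (open_pos v).
Proof.
apply/idP/idP => [/connectP[s]|].
  elim: s r => [|c s IHs] r /=; first by move=> _ ->; have := pos_bounds r; rewrite /within; lia.
  move=> /andP[/child_pos[lt_rc le_cr _] /IHs/[apply]].
  by rewrite /within; lia.
have [n] := ubnP (end_pos r - open_pos r).
elim: n r => // n IHn r ltn; rewrite /within => rv.
have br := pos_bounds r; have ne := open_neq_close v r.
have [/open_pos_inj->|ner] := eqVneq (open_pos v) (open_pos r).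
  exact: connect0.
have [lt|ge] := ltnP (open_pos v) (close_pos r).
  have := left_child_pos r; case E: (child_at true r) => [c|]; last by lia.
  move=> [Eo Ee]; apply: (@connect_trans _ _ c).
    by apply: connect1; rewrite /child E eqxx.
  by apply: IHn; rewrite /within; lia.
have := right_child_pos r; case E: (child_at false r) => [c|]; last by lia.
move=> [Eo Ee]; apply: (@connect_trans _ _ c).
  by apply: connect1; rewrite /child E eqxx orbT.
by apply: IHn; rewrite /within; lia.
Qed.

Lemma within_open v : within v (open_pos v).
Proof. by have := pos_bounds v; rewrite /within; lia. Qed.

(** A nonempty path from [c] to [y] has a last edge, which starts at [x] because parents are
    unique. *)
Lemma within_child c x y :
  child x y -> within c (open_pos y) -> c = y \/ within c (open_pos x).
Proof.
rewrite -!connect_childE => xy /connectP[s]; case/lastP: s => [|s z].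
  by move=> _ ->; left.
rewrite rcons_path last_rcons => /andP[ps zc] Ey; right.
by rewrite Ey in xy; rewrite (child_parent_inj xy zc); apply/connectP; exists s.
Qed.

End Ancestry.

(** * Micro trees as intervals minus the intervals of their exits *)

Section MicroTree.

Variable t : bintree.
Implicit Types (u v r c p : node t) (M : {set node t}).

Lemma topmost_in M r : topmost M r -> r \in M.
Proof. by case/andP. Qed.

Lemma topmost_within M r v : topmost M r -> v \in M -> within r (open_pos v).
Proof. by case/andP=> _ /forall_inP/[apply]; rewrite connect_childE. Qed.

Lemma topmost_inj M r r' : topmost M r -> topmost M r' -> r = r'.
Proof.
move=> tr tr'; apply: open_pos_inj.
have := topmost_within tr (topmost_in tr').
by have := topmost_within tr' (topmost_in tr); rewrite /within; lia.
Qed.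

Lemma position_of_open M v : position_of M (open_pos v) = (v \in M).
Proof.
apply/exists_inP/idP => [[u uM /orP[/eqP/open_pos_inj-> //|]]|vM].
  by rewrite (negbTE (open_neq_close _ _)).
by exists v; rewrite ?eqxx.
Qed.

Lemma position_of_close M v : position_of M (close_pos v) = (v \in M).
Proof.
apply/exists_inP/idP => [[u uM /orP[|/eqP/close_pos_inj-> //]]|vM].
  by rewrite eq_sym (negbTE (open_neq_close _ _)).
by exists v; rewrite ?eqxx ?orbT.
Qed.

(* A connected set of nodes enters a subtree only through its root. *)
Lemma connected_in_entry M c u v :
  connected_in M -> u \in M -> v \in M ->
  ~~ within c (open_pos u) -> within c (open_pos v) ->
  exists2 p, p \in M & child p c && (c \in M).
Proof.
move=> /forall_inP/(_ u)/[apply]/forall_inP/(_ v)/[apply].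
case/connectP=> s; elim: s u => [|w s IHs] u /=; first by move=> _ -> /negP.
case/andP=> /and3P[uM wM adj] ps ev ncu cv.
case: (boolP (within c (open_pos w))) => [cw|ncw]; last exact: (IHs w).
case/orP: adj => [uw|wu]; last first.
  rewrite -!connect_childE in ncu cw; case/negP: ncu.
  exact: connect_trans cw (connect1 wu).
case: (within_child uw cw) => [->|cu]; last by rewrite cu in ncu.
by exists u; rewrite ?uw.
Qed.

Definition exits M : {set node t} :=
  [set c | (c \notin M) && [exists p in M, child p c]].

Lemma exitsP M c :
  reflect (c \notin M /\ exists2 p, p \in M & child p c) (c \in exits M).
Proof.
by rewrite inE; apply: (iffP andP) => -[cM pc]; split=> //; exact/exists_inP.
Qed.

Lemma exit_bounds M r c : topmost M r -> c \in exits M ->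
  [&& open_pos r < open_pos c, open_pos c < end_pos c & end_pos c <= end_pos r].
Proof.
move=> tr /exitsP[_ [p /(topmost_within tr) rp /child_pos[lt_pc le_cp _]]].
have := pos_laminar r p; have := pos_bounds c; move: rp; rewrite /within; lia.
Qed.

(** The first node outside [M] on the path down from [r] to [v] is the exit. *)
Lemma exit_exists M r v :
  r \in M -> v \notin M -> within r (open_pos v) ->
  exists2 c, c \in exits M & within c (open_pos v).
Proof.
rewrite -connect_childE => rM vM /connectP[s].
elim: s r rM => [|w s IHs] r rM /=; first by move=> _ E; rewrite E rM in vM.
case/andP=> rw ps ev; case: (boolP (w \in M)) => wM; first exact: (IHs w).
exists w; first by apply/exitsP; split=> //; exists r.
by rewrite -connect_childE; apply/connectP; exists s.
Qed.

(** A node of [M] below an exit [c] would make the connected set [M] enter the subtree of [c]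
    through [c], forcing [c] into [M]. Conversely, a node below [r] but outside [M] lies below an
    exit. *)
Lemma mem_micro_tree M r v : connected_in M -> topmost M r ->
  (v \in M) =
    within r (open_pos v) && [forall c in exits M, ~~ within c (open_pos v)].
Proof.
move=> cM tr; apply/idP/andP => [vM|[rv /forall_inP out]]; last first.
  apply/negPn/negP => /(exit_exists (topmost_in tr))/(_ rv)[c /out].
  by move/negP.
split; first exact: topmost_within vM.
apply/forall_inP => c cE; apply/negP => cv.
have b := exit_bounds tr cE.
have [|p _ /andP[_ cM']] := connected_in_entry cM (topmost_in tr) vM _ cv.
  by rewrite /within; lia.
by case/exitsP: cE; rewrite cM'.
Qed.

(** Every position carries a parenthesis of some node, and no subtree interval separates the two
    parentheses of a node, so the description of the nodes of [M] transfers to positions. *)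
Lemma position_ofE M r i : connected_in M -> topmost M r ->
  position_of M i = within r i && [forall c in exits M, ~~ within c i].
Proof.
move=> cM tr; have [lti|gei] := ltnP i (size (BPb t)); last first.
  have br := pos_bounds r.
  have -> : within r i = false by rewrite /within; lia.
  apply/negbTE/exists_inP => -[v _]; have := pos_bounds v; lia.
have [v /orP[] /eqP->] := pos_cover lti.
  by rewrite position_of_open; apply: mem_micro_tree.
rewrite position_of_close within_close (mem_micro_tree v cM tr).
by congr (_ && _); apply: eq_forallb => c; rewrite within_close.
Qed.

End MicroTree.

(** * Lexicographic order on intervals *)

Definition lex_le (I J : nat * nat) :=
  (I.1 < J.1) || (I.1 == J.1) && (I.2 <= J.2).

Lemma lex_le_trans : transitive lex_le.
Proof. by move=> [a b] [c d] [e f]; rewrite /lex_le /=; lia. Qed.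

Lemma lex_le_anti : antisymmetric lex_le.
Proof.
by move=> [a b] [c d]; rewrite /lex_le /= => le; congr (_, _); lia.
Qed.

(** Makes the filtered enumeration in [maximal_intervals] sorted, hence determined by its
    elements. *)
Lemma sorted_lex_pairs s s' : sorted ltn s -> sorted ltn s' ->
  sorted lex_le [seq (a, b) | a <- s, b <- s'].
Proof.
rewrite !(sorted_pairwise ltn_trans) (sorted_pairwise lex_le_trans) => + ps'.
elim: s => //= a s IHs /andP[/allP lt_as /IHs ps].
rewrite pairwise_cat ps andbT; apply/andP; split.
  apply/allrelP => _ _ /mapP[b _ ->] /allpairsP[[c d] [/lt_as lt_ac _ ->]].
  by rewrite /lex_le /= lt_ac.
rewrite pairwise_map; apply: sub_pairwise ps' => b c lt_bc.
by rewrite /lex_le /=; lia.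
Qed.

Lemma mem_iota_pairs N a b :
  ((a, b) \in [seq (i, j) | i <- iota 0 N, j <- iota 0 N]) = (a < N) && (b < N).
Proof.
apply/allpairsP/andP => [[[i j] [/=]]|[lt_a lt_b]].
  by rewrite !mem_iota => lt_i lt_j [-> ->].
by exists (a, b); rewrite !mem_iota.
Qed.

(** * Chunks and gaps of a micro tree *)

Section Layout.

Variable t : bintree.
Implicit Types (v r c p : node t) (M : {set node t}).

(** The condition [(x == y) = (y == z)] excludes two adjacent nonempty intervals, which would merge,
    and an empty second interval away from the end of the first. *)
Lemma maximal_intervalsE M a x y z :
  a < x <= y -> y <= z <= size (BPb t) -> (x == y) = (y == z) ->
  (forall i, position_of M i = (a <= i < x) || (y <= i < z)) ->
  maximal_intervals M = (a, x) :: (if y < z then [:: (y, z)] else [::]).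
Proof.
move=> le_axy le_yz exy pos.
apply: (sorted_eq lex_le_trans lex_le_anti).
- apply: (sorted_filter lex_le_trans); apply: sorted_lex_pairs;
    exact: iota_ltn_sorted.
- by case: ifP => // lt_yz; rewrite /= /lex_le /=; lia.
apply: uniq_perm.
- by apply/filter_uniq/allpairs_uniq => [||[? ?] [? ?] _ _ //]; apply: iota_uniq.
- by case: ifP => //= lt_yz; rewrite inE xpair_eqE; lia.
move=> [p q]; rewrite mem_filter.
have -> : ((p, q) \in (a, x) :: (if y < z then [:: (y, z)] else [::])) =
    (p == a) && (q == x) || (p == y) && (q == z) && (y < z).
  by case: ifP => _; rewrite !inE ?xpair_eqE ?andbT ?andbF ?orbF.
rewrite /maximal_interval [(p, q).1]/= [(p, q).2]/= !pos.
apply/idP/idP => [/andP[/and4P[lt_pq /allP all_pq left_p right_q] _]|E].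
  have inpq i : p <= i < q -> (a <= i < x) || (y <= i < z).
    by move=> ipq; rewrite -pos; apply: all_pq; rewrite mem_iota; lia.
  have {left_p} Ep : (p == a) || (p == y) && (y < z).
    by have := inpq p; move: left_p; clear -lt_pq le_axy le_yz; lia.
  have {right_q} Eq : (q == x) || (q == z).
    by have := inpq q.-1; move: right_q; clear -lt_pq le_axy le_yz; lia.
  (* Testing position [x] excludes an interval from [a] to [z] that would cross a nonempty gap. *)
  have {inpq} := inpq x; move: Ep Eq; clear -lt_pq le_axy le_yz exy.
  by case/orP=> [/eqP ?|/andP[/eqP ? ?]] /orP[] /eqP ? ?; subst p q; lia.
have {}E : p = a /\ q = x \/ [/\ p = y, q = z & y < z].
  by case/orP: E => [/andP[/eqP-> /eqP->]|/andP[/andP[/eqP-> /eqP->] ->]]; [left|right].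
have {}E : [/\ p < q, q <= z, forall i, p <= i < q -> (a <= i < x) || (y <= i < z),
    (p == 0) || ~~ ((a <= p.-1 < x) || (y <= p.-1 < z)) & ~~ ((a <= q < x) || (y <= q < z))].
  by case: E => [[-> ->]|[-> -> lt_yz]]; split; try move=> i; lia.
case: E => lt_pq le_qz inpq left_p right_q; apply/andP; split.
  rewrite lt_pq left_p right_q !andbT /=; apply/allP => i.
  by rewrite mem_iota pos => pqi; apply: inpq; move: pqi lt_pq; clear; lia.
by rewrite mem_iota_pairs; move: le_yz le_qz lt_pq; clear; lia.
Qed.

Lemma left_chunkE M a x y z :
  a < x <= y -> y <= z <= size (BPb t) -> (x == y) = (y == z) ->
  (forall i, position_of M i = (a <= i < x) || (y <= i < z)) ->
  left_chunk M = (a, x).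
Proof.
by move=> lt_ax le_yz exy pos; rewrite /left_chunk (maximal_intervalsE lt_ax le_yz).
Qed.

Lemma right_chunkE M a x y z :
  a < x <= y -> y <= z <= size (BPb t) -> (x == y) = (y == z) ->
  (forall i, position_of M i = (a <= i < x) || (y <= i < z)) ->
  right_chunk M = (y, z).
Proof.
move=> lt_ax le_yz exy pos; rewrite /right_chunk (left_chunkE lt_ax le_yz) //.
rewrite (maximal_intervalsE lt_ax le_yz) //.
(* If [y = z], then [x = y] too, so the default value [(x, x)] is [(y, z)]. *)
by case: ifP => //= nlt_yz; congr (_, _); lia.
Qed.

Variable P : {set {set node t}}.
Hypothesis decP : micro_tree_decomposition P.

Let partP : partition P [set: node t]. Proof. by case: decP. Qed.

Lemma micro_connected M : M \in P -> connected_in M.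
Proof. by case: decP => _ H _ _ /H[]. Qed.

Lemma micro_topmost M : M \in P -> exists r, topmost M r.
Proof. by case: decP => _ H _ _ /H[]. Qed.

Lemma micro_eq M M' v : M \in P -> M' \in P -> v \in M -> v \in M' -> M = M'.
Proof.
case/and3P: partP => _ tI _ MP M'P vM vM'.
by rewrite -(def_pblock tI MP vM) (def_pblock tI M'P vM').
Qed.

Lemma micro_tree_of v : v \in pblock P v /\ pblock P v \in P.
Proof.
have vP : v \in cover P by rewrite (cover_partition partP).
by rewrite mem_pblock pblock_mem.
Qed.

(** The topmost node of [M'] cannot have its parent in [M'], since a parent opens before its child.
    So a parent in [M] puts [c] outside [M]. *)
Lemma exit_child_micro_tree M M' c : M \in P -> M' \in P -> topmost M' c ->
  child_micro_tree M M' = (c \in exits M).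
Proof.
move=> MP M'P tc; apply/existsP/exitsP => [[r /andP[tr]]|[_ [p pM pc]]].
  rewrite (topmost_inj tr tc) => /exists_inP[p pM pc]; split; last by exists p.
  apply/negP => cM; have EM := micro_eq MP M'P cM (topmost_in tc).
  rewrite EM in pM; have := topmost_within tc pM; case: (child_pos pc).
  by rewrite /within; lia.
by exists c; rewrite tc; apply/exists_inP; exists p.
Qed.

(** Otherwise the micro tree of [c], being connected, would enter the subtree of [c] from the parent
    of [c]. It would share that parent with [M], hence equal [M], which does not contain [c]. *)
Lemma exit_topmost M c : M \in P -> c \in exits M -> topmost (pblock P c) c.
Proof.
move=> MP /exitsP[cM [p pM pc]]; have [cM' M'P] := micro_tree_of c.
have [r tr] := micro_topmost M'P.
have [Erc|neq_rc] := eqVneq r c; first by rewrite Erc in tr.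
have [|q qM' /andP[qc _]] :=
  connected_in_entry (micro_connected M'P) (topmost_in tr) cM' _ (within_open c).
  have ne : open_pos r != open_pos c by rewrite (inj_eq (@open_pos_inj t)).
  have := topmost_within tr cM'; rewrite /within; lia.
rewrite -(child_parent_inj pc qc) in qM'.
by rewrite (micro_eq MP M'P pM qM') cM' in cM.
Qed.

(** Sending an exit to its micro tree is a bijection onto the child micro trees, so the known bounds
    on child micro trees apply to exits. *)
Lemma card_exits M : M \in P ->
  #|[set M' in P | child_micro_tree M M']| = #|exits M|.
Proof.
move=> MP; have inj : {in exits M &, injective (pblock P)}.
  move=> c d /(exit_topmost MP) tc /(exit_topmost MP) td E.
  by rewrite E in tc; apply: topmost_inj tc td.
rewrite -(card_in_imset inj); congr #|pred_of_set _|; apply/setP => M'.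
rewrite inE; apply/andP/imsetP => [[M'P]|[c cE ->]].
  have [c tc] := micro_topmost M'P.
  rewrite (exit_child_micro_tree MP M'P tc) => cE; exists c => //.
  have [cc cP] := micro_tree_of c; exact: micro_eq (topmost_in tc) cc.
have [_ cP] := micro_tree_of c; split=> //.
by rewrite (exit_child_micro_tree MP cP (exit_topmost MP cE)).
Qed.

(* [l, h) is what the left or right chunk is followed by: nothing or the
   subtree below [M] hanging from one exit. *)
Definition slot M l h :=
  l = h \/ exists c, [/\ c \in exits M, open_pos c = l & end_pos c = h].

Lemma layout M r : M \in P -> topmost M r ->
  exists x y z,
  [/\ [/\ open_pos r < x <= y, y <= z <= end_pos r & (x == y) = (y == z)],
      forall i, position_of M i = (open_pos r <= i < x) || (y <= i < z),
      slot M x y, slot M z (end_pos r)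
    & forall c, c \in exits M ->
        (open_pos c, end_pos c) = (x, y) \/
        (open_pos c, end_pos c) = (z, end_pos r)].
Proof.
move=> MP tr; have posE i := position_ofE i (micro_connected MP) tr.
have br := pos_bounds r; have bE c := @exit_bounds _ _ _ c tr.
have le2 : #|exits M| <= 2 by rewrite -card_exits //; case: decP => _ _ /(_ M MP).
case En: #|exits M| le2 => [|[|[|//]]] _.
- have E0 : exits M = set0 by apply/eqP; rewrite -cards_eq0 En.
  (* Without exits, [M] fills the interval of [r]; the right chunk and both gaps are empty at its
     end. *)
  exists (end_pos r), (end_pos r), (end_pos r); split; [split; lia| |by left|by left|].
    move=> i; rewrite posE /within; have -> : [forall c in exits M, ~~ within c i].
      by apply/forall_inP => c; rewrite E0 inE.
    by lia.
  by move=> c; rewrite E0 inE.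
- have /cards1P[c Ec] : #|exits M| == 1 by rewrite En.
  have cE : c \in exits M by rewrite Ec set11.
  have bc := bE c cE.
  have pos i : position_of M i = within r i && ~~ within c i.
    rewrite posE; congr (_ && _); apply/forall_inP/idP => [->//|nc d].
    by rewrite Ec => /set1P->.
  (* An exit that ends with [r] must fill the last gap: placed between the chunks, it would separate
     the empty right chunk from the left one. Any other single exit is followed by positions of [M]
     and fills the first gap. *)
  have [Ee|ne] := eqVneq (end_pos c) (end_pos r).
    exists (open_pos c), (open_pos c), (open_pos c); split.
    + by split; lia.
    + by move=> i; rewrite pos /within; lia.
    + by left.
    + by right; exists c.
    + by move=> d; rewrite Ec => /set1P->; right; rewrite Ee.
  exists (open_pos c), (end_pos c), (end_pos r); split.
  + by split; lia.
  + by move=> i; rewrite pos /within; lia.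
  + by right; exists c.
  + by left.
  + by move=> d; rewrite Ec => /set1P->; left.
(* With two exits, [M] is reduced to [r]: the chunks are its two parentheses and the gaps its two
   subtrees. *)
- have M1 : #|M| = 1 by case: decP => _ _ _; apply=> //; rewrite card_exits.
  have /cards1P[v Ev] : #|M| == 1 by rewrite M1.
  have Er : r = v by apply/set1P; rewrite -Ev topmost_in.
  rewrite -{}Er in Ev.
  have exE d : d \in exits M ->
      child_at true r = Some d \/ child_at false r = Some d.
    case/exitsP=> _ [p]; rewrite Ev => /set1P-> /orP[] /eqP; by [left|right].
  have /cards2P[c [d [ncd Ecd]]] : #|exits M| == 2 by rewrite En.
  have cE : c \in exits M by rewrite Ecd !inE eqxx.
  have dE : d \in exits M by rewrite Ecd !inE eqxx orbT.
  wlog [Ec Ed] : c d ncd Ecd cE dE /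
      child_at true r = Some c /\ child_at false r = Some d.
    move=> W; case: (exE c cE) (exE d dE) => [] Ec [] Ed.
    + by move: Ed ncd; rewrite Ec => -[->]; rewrite eqxx.
    + exact: (W c d).
    + by apply: (W d c); rewrite // 1?eq_sym // setUC.
    + by move: Ed ncd; rewrite Ec => -[->]; rewrite eqxx.
  have := left_child_pos r; have := right_child_pos r; rewrite Ec Ed.
  move=> [od ed] [oc ec].
  exists (open_pos r).+1, (close_pos r), (close_pos r).+1; split.
  + by have := bE c cE; split; lia.
  + move=> i; apply/exists_inP/idP => [[v' vM]|].
      by move: vM; rewrite Ev => /set1P->; lia.
    by move=> Ei; exists r; rewrite ?(topmost_in tr) //; lia.
  + by right; exists c.
  + by right; exists d.
  + move=> c'; rewrite Ecd => /set2P[] ->; [left|right]; congr (_, _); lia.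
Qed.

End Layout.

Lemma childP t (p c : node t) :
  reflect (exists b, child_at b p = Some c) (child p c).
Proof.
apply: (iffP orP) => [[/eqP E|/eqP E]|[[] ->]]; rewrite ?eqxx.
- by exists true.
- by exists false.
- by left.
- by right.
Qed.

(** * Parentheses paired with their nodes *)

Section Lifts.

Variables l r : bintree.

Definition lift_root b : node (Node l r) * bool := (None, b).

Definition lift_l (x : node l * bool) : node (Node l r) * bool :=
  (Some (inl x.1), x.2).

Definition lift_r (x : node r * bool) : node (Node l r) * bool :=
  (Some (inr x.1), x.2).

Lemma lift_l_inj : injective lift_l.
Proof. by move=> [u b] [v c] [-> ->]. Qed.

Lemma lift_r_inj : injective lift_r.
Proof. by move=> [u b] [v c] [-> ->]. Qed.

Lemma lift_root_notin_l b s : lift_root b \notin map lift_l s.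
Proof. by apply/mapP => -[]. Qed.

Lemma lift_root_notin_r b s : lift_root b \notin map lift_r s.
Proof. by apply/mapP => -[]. Qed.

Lemma lift_r_notin_l x s : lift_r x \notin map lift_l s.
Proof. by apply/mapP => -[]. Qed.

End Lifts.

(** The recursion of [BPb], except that each parenthesis keeps its node; the list can then be
    compared with the list of chunks itself and not only with its parentheses. *)
Fixpoint paren_seq T : seq (node T * bool) :=
  match T return seq (node T * bool) with
  | Empty => [::]
  | Node l r =>
      lift_root l r true :: map (@lift_l l r) (paren_seq l) ++
      lift_root l r false :: map (@lift_r l r) (paren_seq r)
  end.

Lemma paren_seq_Node l r :
  paren_seq (Node l r) =
    lift_root l r true :: map (@lift_l l r) (paren_seq l) ++
    lift_root l r false :: map (@lift_r l r) (paren_seq r).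
Proof. by []. Qed.

Lemma paren_seqE T : [seq x.2 | x <- paren_seq T] = BPb T.
Proof.
elim: T => //= l <- r <-; rewrite map_cat /= -!map_comp.
by congr (_ :: _ ++ _ :: _); apply: eq_map.
Qed.

Lemma size_paren_seq T : size (paren_seq T) = size (BPb T).
Proof. by rewrite -paren_seqE size_map. Qed.

Lemma uniq_paren_seq T : uniq (paren_seq T).
Proof.
elim: T => // l IHl r IHr.
rewrite paren_seq_Node cons_uniq mem_cat inE (negbTE (lift_root_notin_l _ _ _)).
rewrite (negbTE (lift_root_notin_r _ _ _)) orbF andTb cat_uniq cons_uniq.
rewrite (map_inj_uniq (@lift_l_inj l r)) IHl (map_inj_uniq (@lift_r_inj l r)) IHr.
rewrite lift_root_notin_r !andbT andTb; apply/hasPn => x.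
by rewrite inE => /predU1P[->|/mapP[y _ ->]];
  [apply: lift_root_notin_l | apply: lift_r_notin_l].
Qed.

Lemma mem_paren_seq T x b : (x, b) \in paren_seq T.
Proof.
elim: T x b => [[]|l IHl r IHr] x b; rewrite paren_seq_Node inE mem_cat inE.
case: x => [[u|u]|]; apply/or4P.
- by apply: Or42; apply/mapP; exists (u, b).
- by apply: Or44; apply/mapP; exists (u, b).
- by case: b; [apply: Or41 | apply: Or43].
Qed.

Lemma index_paren_seq T (x : node T) b :
  index (x, b) (paren_seq T) = if b then open_pos x else close_pos x.
Proof.
elim: T x b => [[]|l IHl r IHr] x b; rewrite paren_seq_Node.
case: x => [[u|u]|].
- rewrite -[(_, b)]/(lift_l r (u, b)) /= index_cat map_f ?mem_paren_seq //.
  by rewrite (index_map (@lift_l_inj l r)) IHl; case: b.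
- rewrite -[(_, b)]/(lift_r l (u, b)) /= index_cat.
  rewrite (negbTE (lift_r_notin_l _ _)) /= size_map size_paren_seq.
  by rewrite (index_map (@lift_r_inj l r)) IHr; case: b => /=; lia.
- rewrite -[(_, b)]/(lift_root l r b); case: b => //=.
  rewrite index_cat (negbTE (lift_root_notin_l _ _ _)) /=.
  rewrite size_map size_paren_seq. by rewrite addn0.
Qed.

(** * Consecutive intervals *)

(** Empty tiles are allowed because right chunks may be empty. *)
Fixpoint tiles (s : seq (nat * nat)) (a e : nat) : bool :=
  if s is J :: s' then [&& J.1 == a, J.1 <= J.2 & tiles s' J.2 e] else a == e.

Lemma tiles_cat s1 s2 a b e : tiles s1 a b -> tiles s2 b e -> tiles (s1 ++ s2) a e.
Proof.
elim: s1 a => [a /eqP-> //|I s IHs a] /= /and3P[-> -> t1] t2 /=.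
exact: IHs.
Qed.

(** If two successive tiles start at the same position, the first is empty, so comparing the ends
    puts it first. *)
Lemma tiles_sorted s a e : tiles s a e -> sorted lex_le s.
Proof.
elim: s a => //= I [//|J s] IHs a /and3P[_ leI tJ].
have := IHs _ tJ; move: tJ => /= /and3P[/eqP EJ leJ _] ->; rewrite andbT.
by rewrite /lex_le EJ; lia.
Qed.

(** * Recursive construction of the contracted tree *)

Section TopTierTree.

Variables (t : bintree) (P : {set {set node t}}).
Hypothesis decP : micro_tree_decomposition P.

Definition relabel T (f : node T -> {set node t}) (x : node T * bool) :=
  (f x.1, x.2).

Definition graft l r M (fl : node l -> {set node t}) (fr : node r -> {set node t})
    (v : node (Node l r)) : {set node t} :=
  match v with
  | None => M
  | Some (inl u) => fl u
  | Some (inr u) => fr u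
  end.

(* [T], with its nodes labelled by [f], is the contraction of the part of the
   tree encoded by the positions of [a, e). *)
Record contraction T (f : node T -> {set node t}) (a e : nat) : Prop := {
  contraction_mem x : f x \in P;
  contraction_range x r : topmost (f x) r -> a <= open_pos r < e;
  contraction_onto M r :
    M \in P -> topmost M r -> a <= open_pos r < e -> exists x, f x = M;
  contraction_inj : injective f;
  contraction_tiles : tiles [seq chunk (relabel f x) | x <- paren_seq T] a e;
  contraction_child p c : child p c -> child_micro_tree (f p) (f c);
  contraction_child_onto p M :
    M \in P -> child_micro_tree (f p) M -> exists2 c, child p c & f c = M;
  contraction_slot b p c v : child_at b p = Some c -> f p = [set v] ->
    exists2 r, topmost (f c) r & child_at b v = Some r
}.

Lemma contraction_Empty a :
  contraction (fun v : node Empty => match v with end) a a.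
Proof.
split; try by case.
- by move=> M r _ _ r_in; exfalso; lia.
- exact: eqxx.
Qed.

Lemma layout_chunks M r : M \in P -> topmost M r ->
  exists x y z,
  [/\ [/\ open_pos r < x <= y, y <= z <= end_pos r & (x == y) = (y == z)],
      forall i, position_of M i = (open_pos r <= i < x) || (y <= i < z),
      left_chunk M = (open_pos r, x), right_chunk M = (y, z) &
  [/\ slot M x y, slot M z (end_pos r)
    & forall c, c \in exits M ->
        (open_pos c, end_pos c) = (x, y) \/
        (open_pos c, end_pos c) = (z, end_pos r)]].
Proof.
move=> MP tr; have [x [y [z [[ltx ley exy] pos sl sr ex]]]] := layout decP MP tr.
have ley' : y <= z <= size (BPb t) by have := pos_bounds r; lia.
exists x, y, z; split=> //.
  exact: left_chunkE ltx ley' exy pos.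
exact: right_chunkE ltx ley' exy pos.
Qed.

(** The two gaps are disjoint and contain no position of [M], so the labels from the two subtrees
    and from the new root do not collide. Left chunk, first gap, right chunk, second gap is the
    order in which [BPb] expands a node. *)
Lemma contraction_Node M r x y z Tl Tr fl fr : M \in P -> topmost M r ->
  [/\ open_pos r < x <= y, y <= z <= end_pos r & (x == y) = (y == z)] ->
  (forall i, position_of M i = (open_pos r <= i < x) || (y <= i < z)) ->
  left_chunk M = (open_pos r, x) -> right_chunk M = (y, z) ->
  (forall c, c \in exits M ->
     (open_pos c, end_pos c) = (x, y) \/
     (open_pos c, end_pos c) = (z, end_pos r)) ->
  @contraction Tl fl x y -> @contraction Tr fr z (end_pos r) ->
  (if Defs.root Tl is Some u then
     exists c, [/\ c \in exits M, topmost (fl u) c,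
                 open_pos c = x & end_pos c = y] else x = y) ->
  (if Defs.root Tr is Some u then
     exists c, [/\ c \in exits M, topmost (fr u) c,
                 open_pos c = z & end_pos c = end_pos r] else z = end_pos r) ->
  contraction (graft M fl fr) (open_pos r) (end_pos r).
Proof.
move=> MP tr [ltx ley exy] pos lc rc ex Cl Cr rl rr.
have range_l := contraction_range Cl; have range_r := contraction_range Cr.
have top_eq N N' c : N \in P -> N' \in P -> topmost N c -> topmost N' c -> N = N'.
  by move=> NP N'P /topmost_in cN /topmost_in; apply: (micro_eq decP).
have lab_l u := micro_topmost decP (contraction_mem Cl u).
have lab_r u := micro_topmost decP (contraction_mem Cr u).
split.
- case=> [[u|u]|] //=; [exact: contraction_mem Cl u|exact: contraction_mem Cr u].
- case=> [[u|u]|] r' /=.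
  + by move/range_l; lia.
  + by move/range_r; lia.
  + by move/(topmost_inj tr) <-; have := pos_bounds r; lia.
- move=> N r' NP tr' r'in.
  case: (boolP (r' \in M)) => [r'M|].
    by exists None; apply: (micro_eq decP) r'M (topmost_in tr').
  rewrite -position_of_open pos => r'out.
  have [lt|ge] := ltnP (open_pos r') y.
    have [|u <-] := contraction_onto Cl NP tr'; first by lia.
    by exists (Some (inl u)).
  have [|u <-] := contraction_onto Cr NP tr'; first by lia.
  by exists (Some (inr u)).
- case=> [[u|u]|] [[v|v]|] //= E.
  + by rewrite (contraction_inj Cl E).
  + have [c tc] := lab_l u; have := range_l _ _ tc.
    by rewrite E in tc; have := range_r _ _ tc; lia.
  + by rewrite -E in tr; have := range_l _ _ tr; lia.
  + have [c tc] := lab_r u; have := range_r _ _ tc.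
    by rewrite E in tc; have := range_l _ _ tc; lia.
  + by rewrite (contraction_inj Cr E).
  + by rewrite -E in tr; have := range_r _ _ tr; lia.
  + by rewrite E in tr; have := range_l _ _ tr; lia.
  + by rewrite E in tr; have := range_r _ _ tr; lia.
- have Elc : chunk (relabel (graft M fl fr) (lift_root Tl Tr true)) =
      (open_pos r, x) := lc.
  have Erc : chunk (relabel (graft M fl fr) (lift_root Tl Tr false)) =
      (y, z) := rc.
  rewrite paren_seq_Node map_cons map_cat map_cons -!map_comp Elc Erc.
  apply/and3P; split => /=; [by []|lia|].
  apply: (@tiles_cat _ _ _ y); first exact: contraction_tiles Cl.
  by apply/and3P; split => /=; [|lia|exact: contraction_tiles Cr].
- move=> p c /childP[b]; case: p => [[p|p]|] /=.
  + case E: child_at => [d|//] [<-] /=.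
    by apply: (contraction_child Cl); apply/childP; exists b.
  + case E: child_at => [d|//] [<-] /=.
    by apply: (contraction_child Cr); apply/childP; exists b.
  + case: b; case E: Defs.root => [u|//] [<-] /=.
      move: rl; rewrite E => -[d [dE td _ _]].
      by rewrite (exit_child_micro_tree decP MP (contraction_mem Cl u) td).
    move: rr; rewrite E => -[d [dE td _ _]].
    by rewrite (exit_child_micro_tree decP MP (contraction_mem Cr u) td).
- case=> [[p|p]|] N NP /=.
  + move/(contraction_child_onto Cl NP) => [c /childP[b E] <-].
    by exists (Some (inl c)) => //; apply/childP; exists b; rewrite /= E.
  + move/(contraction_child_onto Cr NP) => [c /childP[b E] <-].
    by exists (Some (inr c)) => //; apply/childP; exists b; rewrite /= E.
  + have [c tc] := micro_topmost decP NP.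
    rewrite (exit_child_micro_tree decP MP NP tc) => /ex; have bc := pos_bounds c.
    case=> -[oc ec].
      (* The exit has a nonempty interval, so this gap is not empty and [Tl] has a root. *)
      case E: (Defs.root Tl) rl => [u|]; last by lia.
      case=> d [_ td od _]; exists (Some (inl u)).
        by apply/childP; exists true; rewrite /= E.
      have Ecd : d = c by apply: open_pos_inj; rewrite od.
      by rewrite Ecd in td; apply: (top_eq _ _ c) => //; apply: contraction_mem Cl u.
    case E: (Defs.root Tr) rr => [u|]; last by lia.
    case=> d [_ td od _]; exists (Some (inr u)).
      by apply/childP; exists false; rewrite /= E.
    have Ecd : d = c by apply: open_pos_inj; rewrite od.
    by rewrite Ecd in td; apply: (top_eq _ _ c) => //; apply: contraction_mem Cr u.
- move=> b [[p|p]|] c v /=.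
  + by case E: child_at => [d|//] [<-] /=; apply: contraction_slot Cl b p d v E.
  + by case E: child_at => [d|//] [<-] /=; apply: contraction_slot Cr b p d v E.
  + move=> + EM; have Er : r = v by apply/set1P; rewrite -EM topmost_in.
    have exE d : d \in exits M -> exists b', child_at b' v = Some d.
      by case/exitsP=> _ [p]; rewrite EM => /set1P-> /childP.
    have br := pos_bounds r.
    case: b; case E: Defs.root => [u|//] [<-] /=.
      move: rl; rewrite E => -[d [/exE[[] Ed] td od ed]]; first by exists d.
      (* A right child would end with [r], giving [y = z = end_pos r], hence [x = y] and an empty
         interval for [d]. *)
      have := right_child_pos v; have := pos_bounds d.
      by rewrite Ed -Er; lia.
    move: rr; rewrite E => -[d [/exE[[] Ed] td od ed]]; last by exists d.
    (* A left child would end at the closing parenthesis of [r], strictly before [end_pos r]. *)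
    by have := left_child_pos v; rewrite Ed -Er; lia.
Qed.

(** Strong induction on the length of the interval of [r]: an exit opens after [r] and ends no
    later, so its interval is shorter. *)
Lemma contraction_subtree M r : M \in P -> topmost M r ->
  exists T (f : node T -> {set node t}), contraction f (open_pos r) (end_pos r) /\
    exists2 u, Defs.root T = Some u & f u = M.
Proof.
have [n] := ubnP (end_pos r - open_pos r).
elim: n M r => // n IHn M r ltn MP tr.
have [x [y [z [bnd pos lc rc [sl sr ex]]]]] := layout_chunks MP tr.
have sub a b : slot M a b -> exists T (f : node T -> {set node t}),
    contraction f a b /\
    if Defs.root T is Some u then
      exists c, [/\ c \in exits M, topmost (f u) c, open_pos c = a & end_pos c = b]
    else a = b.
  case=> [->|[c [cE <- <-]]].
    by exists Empty, (fun v : node Empty => match v with end); split=> //;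
      apply: contraction_Empty.
  have tc := exit_topmost decP MP cE; have bc := exit_bounds tr cE.
  have [_ cP] := micro_tree_of decP c.
  have [|T [f [Cf [u Eu fu]]]] := IHn _ c _ cP tc; first by lia.
  by exists T, f; split=> //; rewrite Eu; exists c; rewrite fu.
have [Tl [fl [Cl rl]]] := sub _ _ sl; have [Tr [fr [Cr rr]]] := sub _ _ sr.
exists (Node Tl Tr), (graft M fl fr); split; last by exists None.
exact: (contraction_Node MP tr bnd pos lc rc ex Cl Cr rl rr).
Qed.

Lemma contraction_tree : exists T (f : node T -> {set node t}),
  contraction f 0 (size (BPb t)).
Proof.
case Er: (Defs.root t) => [r|]; last first.
  exists Empty, (fun v : node Empty => match v with end).
  by rewrite [t in BPb t](root_None Er); apply: contraction_Empty.
have [or er] := root_pos Er; have [rM MP] := micro_tree_of decP r.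
have [r' tr'] := micro_topmost decP MP.
(* The topmost node opens no later than the root, which opens at position 0. *)
have Er' : r' = r.
  apply: open_pos_inj; have := topmost_within tr' rM.
  by rewrite /within or; lia.
rewrite Er' in tr'; have [T [f [Cf _]]] := contraction_subtree MP tr'.
by exists T, f; rewrite -or -er.
Qed.

Lemma micro_eq_position M M' i : M \in P -> M' \in P ->
  position_of M i -> position_of M' i -> M = M'.
Proof.
move=> MP M'P /exists_inP[u uM Eu] /exists_inP[v vM Ev].
suff Euv : u = v by rewrite -Euv in vM; apply: (micro_eq decP) uM vM.
case/orP: Eu Ev => /eqP-> /orP[] /eqP.
- exact: open_pos_inj.
- by move=> E; have := open_neq_close u v; rewrite E eqxx.
- by move=> E; have := open_neq_close v u; rewrite E eqxx.
- exact: close_pos_inj.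
Qed.

(* An empty right chunk is recovered from the left chunk that it ends. *)
Lemma chunk_inj : {in [pred c | c.1 \in P] &, injective (@chunk t)}.
Proof.
move=> [M b] [M' b']; rewrite !inE /= => MP M'P.
have [r tr] := micro_topmost decP MP; have [r' tr'] := micro_topmost decP M'P.
have [x [y [z [[ltx ley exy] pos lc rc _]]]] := layout_chunks MP tr.
have [x' [y' [z' [[ltx' ley' exy'] pos' lc' rc' _]]]] := layout_chunks M'P tr'.
have common i : position_of M i -> position_of M' i -> M = M'.
  exact: micro_eq_position.
rewrite /chunk /=; case: b; case: b'; rewrite ?lc ?rc ?lc' ?rc'.
- case=> E1 E2; rewrite (common (open_pos r)) ?pos ?pos' //; lia.
- case=> E1 E2; have EM : M = M' by apply: (common (open_pos r)); rewrite ?pos ?pos'; lia.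
  by move: lc' rc'; rewrite -EM lc rc => -[? ?] [? ?]; lia.
- case=> E1 E2; have EM : M = M' by apply: (common (open_pos r')); rewrite ?pos ?pos'; lia.
  by move: lc' rc'; rewrite -EM lc rc => -[? ?] [? ?]; lia.
(* The common position is the start of the right chunk, or, when that chunk is empty, the last
   position of the left chunk. *)
- case=> E1 E2; rewrite (common (if y < z then y else x.-1)) // ?pos ?pos';
    by case: ifP; lia.
Qed.

Lemma size_maximal_intervals M : M \in P -> 1 <= size (maximal_intervals M) <= 2.
Proof.
move=> MP; have [r tr] := micro_topmost decP MP.
have [x [y [z [[ltx ley exy] pos _ _ _]]]] := layout decP MP tr.
rewrite (maximal_intervalsE ltx _ exy pos); first by case: ifP.
by have := pos_bounds r; lia.
Qed.

Lemma size_contracted_parens : size (contracted_parens P) = 2 * #|P|.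
Proof. by rewrite size_map size_sort size_allpairs mulnC cardE. Qed.

(** * From the contraction to the top-tier tree *)

Section Conclusion.

Variables (T : bintree) (f : node T -> {set node t}).
Hypothesis Cf : contraction f 0 (size (BPb t)).

Lemma contraction_surj M : M \in P -> exists x, f x = M.
Proof.
move=> MP; have [r tr] := micro_topmost decP MP.
by apply: (contraction_onto Cf MP tr); have := pos_bounds r; lia.
Qed.

Lemma relabel_inj : injective (relabel f).
Proof. by move=> [x b] [y c] [/(contraction_inj Cf)-> ->]. Qed.

(** Both lists are sorted and have the same elements: tiling sorts the right-hand side, and
    injectivity of [chunk] makes [chunk_le] antisymmetric on these elements. *)
Lemma chunksE : chunks P = map (relabel f) (paren_seq T).
Proof.
have le_trans : transitive (@chunk_le t).
  by move=> c d e; apply: lex_le_trans.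
set s := [seq (M, b) | M <- enum P, b <- [:: true; false]].
have mem_s c : (c \in s) = (c.1 \in P).
  apply/allpairsP/idP => [[[M b] [/= + _ ->]]|cP]; first by rewrite mem_enum.
  by exists c; rewrite mem_enum; case: c cP => M [].
apply: (@sorted_eq_in _ (@chunk_le t)).
- by move=> c d e _ _ _; apply: le_trans.
- move=> c d; rewrite !mem_sort !mem_s => cP dP /lex_le_anti.
  exact: chunk_inj.
- by apply: sort_sorted => c d; rewrite /chunk_le; lia.
- by have := tiles_sorted (contraction_tiles Cf); rewrite map_comp sorted_map.
rewrite perm_sort; apply: uniq_perm.
- by apply: allpairs_uniq; rewrite ?enum_uniq // => -[? ?] [? ?].
- by rewrite (map_inj_uniq relabel_inj) uniq_paren_seq.
move=> [M b]; rewrite mem_s; apply/idP/mapP => /= [MP|[[x c] _ [-> _]]].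
  by have [x <-] := contraction_surj MP; exists (x, b); rewrite ?mem_paren_seq.
exact: contraction_mem Cf x.
Qed.

Lemma contraction_parens : BPb T = contracted_parens P.
Proof. by rewrite /contracted_parens chunksE -map_comp -paren_seqE. Qed.

Lemma contraction_index x :
  open_pos x = index (f x, true) (chunks P) /\
  close_pos x = index (f x, false) (chunks P).
Proof.
rewrite chunksE -[(f x, true)]/(relabel f (x, true)).
rewrite -[(f x, false)]/(relabel f (x, false)) !(index_map relabel_inj).
by rewrite !index_paren_seq.
Qed.

Lemma contraction_top_tier : top_tier_tree P f.
Proof.
have childE p c : child p c = child_micro_tree (f p) (f c).
  apply/idP/idP; first exact: contraction_child Cf _ _.
  move/(contraction_child_onto Cf (contraction_mem Cf c)) => [d pd].
  by move/(contraction_inj Cf) <-.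
split=> // [||p c v b Ep].
- exact: contraction_inj Cf.
- apply/setP => M; apply/imsetP/idP => [[x _ ->]|/contraction_surj[x <-]].
    exact: contraction_mem Cf x.
  by exists x.
apply/eqP/exists_inP => [E|[r tr /eqP Er]].
  by have [r tr Er] := contraction_slot Cf E Ep; exists r; rewrite ?Er.
have /childP[b' E] : child p c.
  rewrite childE Ep; apply/existsP; exists r; rewrite tr /=.
  by apply/exists_inP; exists v; rewrite ?set11 //; apply/childP; exists b.
have [r' tr'] := contraction_slot Cf E Ep; rewrite -(topmost_inj tr tr') => Er'.
(* The slots agree because the left and right children of [v] open at different positions. *)
suff -> : b = b' by [].
have := pos_bounds v; have := left_child_pos v; have := right_child_pos v.
by case: b b' Er Er' {E} => [] [] // -> ->; lia.
Qed.

End Conclusion.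

End TopTierTree.

Theorem theorem13
    (FM : nat -> forall t : bintree, {set {set node t}})
    (FMP : farzan_munro_spec FM)
    (B : nat) (B_gt0 : 0 < B) (t : bintree) (P : {set {set node t}})
    (defP : P = FM B t) :
  [/\ forall M, M \in P -> 1 <= size (maximal_intervals M) <= 2,
      size (contracted_parens P) = 2 * #|P|
    & exists (T : bintree) (f : node T -> {set node t}),
      [/\ BPb T = contracted_parens P,
          forall x : node T,
            open_pos x = index (f x, true) (chunks P) /\
            close_pos x = index (f x, false) (chunks P)
        & top_tier_tree P f]].
Proof.
have decP : micro_tree_decomposition P by rewrite defP; apply: FMP.
split; first by move=> M; apply: size_maximal_intervals.
  exact: size_contracted_parens.
have [T [f Cf]] := contraction_tree decP; exists T, f; split.
- exact: contraction_parens Cf.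
- exact: contraction_index Cf.
- exact: contraction_top_tier Cf.
Qed.
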